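(* Let $G=\mathrm{Spin}_{2n}$ with $n\ge4$ (type $D_n$), let $P=P_I=P^{\alpha_r}$ with $r\in\{1,n-1,n\}$ be a minuscule parabolic subgroup, let $w\in W^I$ with $w\ne1$, and let $\widehat w'=(w'_1,\ldots,w'_m)$ be the generalised reduced decomposition of $w$ obtained by Construction 1 for an arbitrary ordering of the peaks of $Q_w$. Let $\alpha$ be the unique simple root such that $(w'_1)^{-1}(\alpha)$ is a negative root. Then $$(w'_1)^{-1}(\alpha)\ \ge\ w^{-1}(\alpha).$$ Further, $(w'_1)^{-1}(\alpha)=w^{-1}(\alpha)$ if and only if $w=w'_1$, that is, $m=1$.
   Context: $G$ has maximal torus $T$ and Borel subgroup $B\supset T$, root system $R$ with positive roots $R^+$ and simple roots $S=\{\alpha_1,\ldots,\alpha_n\}$ (Bourbaki numbering of $D_n$), Weyl group $W=N_G(T)/T$ with simple reflections $s_i=s_{\alpha_i}$ and length $\ell$. For characters $\lambda,\mu$ of $T$, $\lambda\ge\mu$ means that $\lambda-\mu$ is a nonnegative integral linear combination of simple roots. For $I\subset S$, $P_I$ is the parabolic subgroup generated by $B$ and representatives of $s_\alpha$, $\alpha\in I$; $P^{\alpha}=P_{S\setminus\{\alpha\}}$; $W^I=\{w\in W: w(\beta)\in R^+\ \forall\beta\in I\}$. The minuscule simple roots in type $D_n$ are $\alpha_1,\alpha_{n-1},\alpha_n$. Quiver. Fix a reduced decomposition $w=s_{i_1}\cdots s_{i_k}$ and put $\beta(j)=\alpha_{i_j}$. The successor of $i\in[1,k]$ is $s(i)=\min\{j>i:\beta(j)=\beta(i)\}$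 if it exists. The quiver $Q_w$ has vertex set $[1,k]$ and an arrow $i\to j$ if $\langle\beta(j)^\vee,\beta(i)\rangle\ne0$ and $i<j<s(i)$ (only $i<j$ if $s(i)$ does not exist). Let $\preceq_Q$ be the partial order on vertices generated by $i\preceq_Q j$ whenever there is an arrow $i\to j$. Peaks are the minimal vertices for $\preceq_Q$. (The quiver does not depend on the reduced decomposition.) Construction 1. Choose any ordering $(p_1,\ldots,p_m)$ of the set of peaks of $Q_w$. Define inductively $V_t$ as the set of vertices $v\notin V_1\cup\cdots\cup V_{t-1}$ such that $p_u\not\preceq_Q v$ for all $u>t$; let $w'_t$ be the product of the $s_{\beta(v)}$, $v\in V_t$, in increasing order of $v$. Then $w=w'_1\cdots w'_m$ and $\ell(w)=\sum_t\ell(w'_t)$; the sequence $(w'_1,\ldots,w'_m)$ is the generalised reduced decomposition obtained by Construction 1. It is known that there is exactly one simple root $\alpha$ with $(w'_1)^{-1}(\alpha)$ negative. *)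

(* Defs.v *)
(* MathComp *)
From HB Require Import structures.
From mathcomp Require Import all_boot all_order all_algebra.

Set Implicit Arguments.
Unset Strict Implicit.
Unset Printing Implicit Defensive.

Import GRing.Theory Num.Theory.
Local Open Scope ring_scope.

(* Root system of type D_n (root datum of Spin_2n) in Bourbaki's coordinates:
   characters of T are column vectors over rat with basis e_1, ..., e_n.
   All indices are shifted by one: index i : 'I_n stands for Bourbaki's i + 1. *)

Definition evec (n i : nat) : 'cV[rat]_n := \col_(j < n) (j == i :> nat)%:R.

(* alpha_i = e_i - e_(i+1) for i < n, and alpha_n = e_(n-1) + e_n *)
Definition simple_root (n : nat) (i : 'I_n) : 'cV[rat]_n :=
  if (i.+1 < n)%N then evec n i - evec n i.+1 else evec n n.-2 + evec n n.-1.

Definition pos_root (n : nat) (v : 'cV[rat]_n) : bool :=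
  [exists i : 'I_n, exists j : 'I_n,
     (i < j)%N && ((v == evec n i - evec n j) || (v == evec n i + evec n j))].

Definition neg_root (n : nat) (v : 'cV[rat]_n) : bool := pos_root (- v).

Definition minuscule_index (n : nat) (r : 'I_n) : bool :=
  [|| r == 0 :> nat, r == n.-2 :> nat | r == n.-1 :> nat].

(* la >= mu *)
Definition dominates (n : nat) (la mu : 'cV[rat]_n) : Prop :=
  exists c : 'I_n -> nat, la - mu = \sum_i (c i)%:R *: simple_root i.

(* a^vee = 2 a / (a, a), as a linear form *)
Definition coroot (n : nat) (a : 'cV[rat]_n) : 'rV[rat]_n :=
  (2 / (a^T *m a) 0 0) *: a^T.

Definition pairing (n : nat) (a v : 'cV[rat]_n) : rat := (coroot a *m v) 0 0.

(* The matrix of v |-> v - <a^vee, v> a *)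
Definition reflection (n : nat) (a : 'cV[rat]_n) : 'M[rat]_n :=
  1%:M - a *m coroot a.

Definition simple_reflection (n : nat) (i : 'I_n) : 'M[rat]_n :=
  reflection (simple_root i).

(* Elements of W are matrices acting on the left of characters, so that the
   word i_1 ... i_k is sent to the composite s_(i_1) o ... o s_(i_k). *)
Definition word_prod (n : nat) (s : seq 'I_n) : 'M[rat]_n :=
  \big[mulmx/1%:M]_(i <- s) simple_reflection i.

(* The simple reflections are involutions, hence words give the whole group. *)
Definition weyl (n : nat) (w : 'M[rat]_n) : Prop :=
  exists s : seq 'I_n, w = word_prod s.

(* W^I *)
Definition min_coset_rep (n : nat) (I : {set 'I_n}) (w : 'M[rat]_n) : Prop :=
  weyl w /\ forall i : 'I_n, i \in I -> pos_root (w *m simple_root i).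

Definition reduced_decomposition (n : nat) (w : 'M[rat]_n) (s : seq 'I_n) : Prop :=
  word_prod s = w /\
  forall s' : seq 'I_n, word_prod s' = w -> (size s <= size s')%N.

Section Quiver.

Variables (n k : nat) (s : k.-tuple 'I_n).

Definition beta (i : 'I_k) : 'cV[rat]_n := simple_root (tnth s i).

Definition is_successor (i j : 'I_k) : bool :=
  [&& (i < j)%N, beta j == beta i
    & [forall l : 'I_k, ((i < l)%N && (beta l == beta i)) ==> (j <= l)%N]].

(* The last condition is void when i has no successor. *)
Definition arrow : rel 'I_k := fun i j =>
  [&& pairing (beta j) (beta i) != 0, (i < j)%N
    & [forall l : 'I_k, is_successor i l ==> (j < l)%N]].

Definition quiver_le : rel 'I_k := connect arrow.

Definition peaks : {set 'I_k} :=
  [set i | [forall j : 'I_k, quiver_le j i ==> (j == i)]].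

Definition peak_ordering (m : nat) (p : m.-tuple 'I_k) : Prop :=
  uniq p /\ p =i peaks.

Section Construction1.

Variables (m : nat) (p : m.-tuple 'I_k).

(* V_t, given the union U of the previous sets; t is counted from 0 *)
Definition next_block (U : {set 'I_k}) (t : nat) : {set 'I_k} :=
  [set v | (v \notin U) &&
     [forall u : 'I_m, (t < u)%N ==> ~~ quiver_le (tnth p u) v]].

Fixpoint blocks_before (t : nat) : {set 'I_k} :=
  if t is t'.+1 then blocks_before t' :|: next_block (blocks_before t') t'
  else set0.

Definition block (t : nat) : {set 'I_k} := next_block (blocks_before t) t.

(* w'_(t+1); the elements of the block are enumerated in increasing order. *)
Definition factor (t : nat) : 'M[rat]_n :=
  \big[mulmx/1%:M]_(v <- enum (block t)) reflection (beta v).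

Definition generalised_decomposition : m.-tuple 'M[rat]_n :=
  [tuple factor t | t < m].

End Construction1.

End Quiver.

(* Main.v *)
(* Write w = s_(i_1) ... s_(i_k).  The roots eta_j = s_(i_k) ... s_(i_(j+1)) (alpha_(i_j))
   inverted by w all have alpha_r-coefficient 1, hence pair nonnegatively with
   one another.  Since -w^-1(alpha) is one of them, applying the letters of w
   that follow w'_1 to -w'_1^-1(alpha) one at a time never decreases the root,
   which gives the inequality.

   If equality holds, then g = -w^-1(alpha) is orthogonal to every letter
   outside V_1, including alpha_r.  Let e be the inverted root attached to the
   first vertex q outside V_1; q is a peak, w e = -beta(q), and e lies in the
   span of these letters.  Then g - e is a sum of simple roots other than
   alpha_r, so w (g - e) = beta(q) - alpha has positive height, contradiction. *)

Require Import Defs.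
From HB Require Import structures.
From mathcomp Require Import all_boot all_order all_algebra.
From mathcomp Require Import zify lra ring.

Set Implicit Arguments.
Unset Strict Implicit.
Unset Printing Implicit Defensive.

Import Order.TTheory GRing.Theory Num.Theory.
Local Open Scope ring_scope.

(* With goal [False], [lra] may pick an equation of the wrong type. *)
Ltac absurd_lra :=
  exfalso; have : (1 : rat) < 0; [lra | by rewrite ltr10].

(** * Roots of D_n as integral vectors of square length 2 *)

Section Dot.
Variable n : nat.
Implicit Types (u v x : 'cV[rat]_n).

Definition dot u v : rat := (u^T *m v) 0 0.

Lemma dotE u v : dot u v = \sum_i u i 0 * v i 0.
Proof. by rewrite /dot mxE; apply: eq_bigr => i _; rewrite mxE. Qed.

Lemma dotC u v : dot u v = dot v u.
Proof. by rewrite !dotE; apply: eq_bigr => i _; rewrite mulrC. Qed.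

Lemma dotDr u v x : dot u (v + x) = dot u v + dot u x.
Proof. by rewrite /dot mulmxDr mxE. Qed.

Lemma dotNr u v : dot u (- v) = - dot u v.
Proof. by rewrite /dot mulmxN mxE. Qed.

Lemma dotBr u v x : dot u (v - x) = dot u v - dot u x.
Proof. by rewrite dotDr dotNr. Qed.

Lemma dotZr c u v : dot u (c *: v) = c * dot u v.
Proof. by rewrite /dot -scalemxAr mxE. Qed.

Lemma dot0r u : dot u 0 = 0.
Proof. by rewrite /dot mulmx0 mxE. Qed.

Lemma dotDl u v x : dot (u + v) x = dot u x + dot v x.
Proof. by rewrite dotC dotDr !(dotC x). Qed.

Lemma dotNl u v : dot (- u) v = - dot u v.
Proof. by rewrite dotC dotNr dotC. Qed.

Lemma dotBl u v x : dot (u - v) x = dot u x - dot v x.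
Proof. by rewrite dotDl dotNl. Qed.

Lemma dotZl c u v : dot (c *: u) v = c * dot u v.
Proof. by rewrite dotC dotZr dotC. Qed.

Lemma dot_mulmxr (A : 'M[rat]_n) u v : dot u (A *m v) = dot (A^T *m u) v.
Proof. by rewrite /dot mulmxA trmx_mul trmxK. Qed.

Lemma dot_ge0 u : 0 <= dot u u.
Proof. by rewrite dotE sumr_ge0 // => i _; rewrite -expr2 sqr_ge0. Qed.

Lemma dot_eq0 u : (dot u u == 0) = (u == 0).
Proof.
apply/eqP/eqP => [|->]; last by rewrite dot0r.
rewrite dotE => /psumr_eq0P u0; apply/colP => i; rewrite mxE.
have /eqP := u0 (fun i _ => sqr_ge0 (u i 0)) i isT.
by rewrite mulf_eq0 orbb => /eqP.
Qed.

Lemma dot_col_evec (F : nat -> rat) (i : nat) :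
  (i < n)%N -> dot (\col_j F j) (evec n i) = F i.
Proof.
move=> lin; rewrite dotE (bigD1 (Ordinal lin)) //= !mxE eqxx mulr1 big1 ?addr0 //.
move=> j neq; rewrite !mxE; case: eqP => [eji|]; last by rewrite mulr0.
by case/eqP: neq; apply: val_inj.
Qed.

Lemma dot_evec (i j : nat) :
  (j < n)%N -> dot (evec n i) (evec n j) = (i == j)%:R.
Proof. by move=> ljn; rewrite (dot_col_evec (fun k => (k == i)%:R)) // eq_sym. Qed.

Definition integral v := forall i, v i 0 \is a Num.int.

Lemma integralB u v : integral u -> integral v -> integral (u - v).
Proof. by move=> hu hv i; rewrite !mxE rpredB. Qed.

Lemma integralD u v : integral u -> integral v -> integral (u + v).
Proof. by move=> hu hv i; rewrite !mxE rpredD. Qed.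

Lemma integralZ c u : c \is a Num.int -> integral u -> integral (c *: u).
Proof. by move=> hc hu i; rewrite !mxE rpredM. Qed.

Lemma integral_evec i : integral (evec n i).
Proof. by move=> j; rewrite mxE. Qed.

Lemma dot_int u v : integral u -> integral v -> dot u v \is a Num.int.
Proof. by move=> hu hv; rewrite dotE rpred_sum // => i _; rewrite rpredM. Qed.

(** In this form, stability under reflections is a direct computation; [root_form] recovers the
    signed sums of two basis vectors. *)
Definition is_root v := integral v /\ dot v v = 2.

Lemma is_rootN v : is_root v -> is_root (- v).
Proof.
move=> [vint v2]; split; last by rewrite dotNl dotNr opprK.
by move=> i; rewrite mxE rpredN.
Qed.

Lemma int_neq0_sqr_ge1 (c : rat) : c \is a Num.int -> c != 0 -> 1 <= c * c.
Proof.
move=> /intrP[z ->]; rewrite intr_eq0 => z0.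
by rewrite -intrM ler1z; nia.
Qed.

Lemma int_sqr_le2 (c : rat) :
  c \is a Num.int -> c != 0 -> c * c <= 2 -> exists b : bool, c = (-1) ^+ b.
Proof.
move=> /intrP[z ->]; rewrite intr_eq0 => z0.
rewrite -intrM (_ : 2 = 2%:~R) // ler_int => z2.
have [->|->] : z = 1 \/ z = -1 by nia.
  by exists false.
by exists true.
Qed.

(** A nonzero integral coordinate has square at least 1 and here at most 2, so it is 1 or -1; the
    total 2 leaves exactly two of them. *)
Lemma root_form v : is_root v -> exists (i j : 'I_n) (b c : bool),
  (i < j)%N /\ v = (-1) ^+ b *: evec n i + (-1) ^+ c *: evec n j.
Proof.
case=> vint; rewrite dotE => v2.
have nz (P : pred 'I_n) : \sum_(i | P i) v i 0 * v i 0 != 0 ->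
    exists2 i, P i & v i 0 != 0.
  move=> s0; case: (pickP (fun i => P i && (v i 0 != 0))) => [i /andP[]|none].
    by exists i.
  case/eqP: s0; apply: big1 => i Pi; move/(_ i): none; rewrite Pi /=.
  by move/negbFE/eqP => ->; rewrite mulr0.
have pos (P : pred 'I_n) : 0 <= \sum_(i | P i) v i 0 * v i 0.
  by apply: sumr_ge0 => i _; rewrite -expr2 sqr_ge0.
have [i _ vi0] : exists2 i, xpredT i & v i 0 != 0 by apply: nz; rewrite v2.
move: v2; rewrite (bigD1 i) //= => v2.
have vi1 : v i 0 * v i 0 <= 2 by move: (pos (fun k => k != i)); lra.
have [b vib] := int_sqr_le2 (vint i) vi0 vi1.
have vi2 : v i 0 * v i 0 = 1 by rewrite vib -expr2 sqrr_sign.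
have [j ji vj0] : exists2 j, j != i & v j 0 != 0 by apply: nz; apply/eqP; lra.
move: v2; rewrite (bigD1 j) //= => v2.
have := int_neq0_sqr_ge1 (vint j) vj0; set r := (X in _ + (_ + X) = _) in v2.
have r0 : 0 <= r by exact: pos.
move=> vj1; have [c vjc] : exists c : bool, v j 0 = (-1) ^+ c.
  by apply: int_sqr_le2 => //; lra.
have /psumr_eq0P : r = 0 by lra.
move=> /(_ (fun k _ => sqr_ge0 (v k 0))) rest.
have vE : v = (-1) ^+ b *: evec n i + (-1) ^+ c *: evec n j.
  apply/colP => k; rewrite !mxE !val_eqE.
  have [->|nki] := eqVneq k i.
    by rewrite eq_sym (negPf ji) mulr1 mulr0 addr0.
  have [->|nkj] := eqVneq k j.
    by rewrite mulr0 mulr1 add0r.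
  rewrite !mulr0 addr0.
  have /eqP : v k 0 * v k 0 = 0 by apply: rest; rewrite nki.
  by rewrite mulf_eq0 orbb => /eqP.
move: ji; rewrite -val_eqE neq_ltn /= => /orP[] ltij.
  by exists j, i, c, b; rewrite addrC.
by exists i, j, b, c.
Qed.

(** The half-sum of the positive roots of $D_n$, with entries n-1, ..., 1, 0. It has product 1 with
    each simple root, so it measures heights. *)
Definition rho : 'cV[rat]_n := \col_(j < n) (n.-1 - j)%N%:R.

Definition ht v := dot rho v.

Lemma ht_evec (i : nat) : (i < n)%N -> ht (evec n i) = (n.-1 - i)%N%:R.
Proof. exact: (@dot_col_evec (fun j => (n.-1 - j)%N%:R)). Qed.

Lemma ht_evec_lt (i j : 'I_n) :
  (i < j)%N -> 0 <= ht (evec n j) < ht (evec n i).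
Proof. by move=> ltij; rewrite !ht_evec // ltr_nat ler0n; have := ltn_ord j; lia. Qed.

Lemma ht_int v : integral v -> ht v \is a Num.int.
Proof. by apply: dot_int => i; rewrite mxE. Qed.

(** The entries of [rho] are strictly decreasing and nonnegative, so the first nonzero coordinate of
    a root decides the sign of its height. *)
Lemma root_ht_neq0 v : is_root v -> ht v != 0.
Proof.
case/root_form => i [j [b [c [ltij ->]]]].
rewrite /ht dotDr !dotZr -!/(ht _); have /andP[] := ht_evec_lt ltij.
by case: b c => -[] *; apply/eqP; rewrite ?expr0 ?expr1; lra.
Qed.

Definition sign_root (i j : 'I_n) (b : bool) : 'cV[rat]_n :=
  evec n i + (-1) ^+ b *: evec n j.

Lemma pos_rootP v :
  reflect (exists (i j : 'I_n) (b : bool), (i < j)%N /\ v = sign_root i j b)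
          (pos_root v).
Proof.
apply: (iffP existsP) => [[i /existsP[j /andP[ltij /orP[]/eqP ->]]]|].
- by exists i, j, true; rewrite /sign_root expr1 scaleN1r.
- by exists i, j, false; rewrite /sign_root scale1r.
move=> [i [j [b [ltij ->]]]]; exists i; apply/existsP; exists j.
rewrite ltij /sign_root; case: b; rewrite ?expr1 ?scaleN1r ?scale1r ?eqxx //.
by rewrite orbT.
Qed.

Lemma pos_root_root v : pos_root v -> is_root v.
Proof.
case/pos_rootP=> i [j [b [ltij ->]]]; split.
  apply: integralD; first exact: integral_evec.
  by apply: integralZ; [rewrite rpred_sign | exact: integral_evec].
rewrite /sign_root dotDl !dotDr !dotZr !dotZl !dot_evec // !eqxx.
by rewrite (gtn_eqF ltij) (ltn_eqF ltij) mulr0n mulr1n; case: b;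
  rewrite ?expr0 ?expr1; lra.
Qed.

Lemma pos_rootE v : is_root v -> pos_root v = (0 < ht v).
Proof.
move=> rv; apply/idP/idP.
  case/pos_rootP=> i [j [b [ltij ->]]].
  rewrite /ht /sign_root dotDr dotZr -!/(ht _); have /andP[] := ht_evec_lt ltij.
  by case: b => *; rewrite ?expr0 ?expr1; lra.
case/root_form: rv => i [j [b [c [ltij ->]]]].
rewrite /ht dotDr !dotZr -!/(ht _) => h.
apply/pos_rootP; exists i, j, c; split=> //; rewrite /sign_root.
suff -> : b = false by rewrite scale1r.
apply/negP => bT; move: h; rewrite bT; have /andP[] := ht_evec_lt ltij.
by case: c; rewrite ?expr0 ?expr1; lra.
Qed.

Lemma root_dot_le2 u v : is_root u -> is_root v -> dot u v <= 2 ?= iff (u == v).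
Proof.
move=> [_ u2] [_ v2]; have d : dot (u - v) (u - v) = 4 - 2 * dot u v.
  by rewrite dotBl !dotBr (dotC v) u2 v2; lra.
split; first by have := dot_ge0 (u - v); lra.
by rewrite -[u == v]subr_eq0 -dot_eq0 d; apply/eqP/eqP; lra.
Qed.

End Dot.

(** * Reduced words *)

Section Words.
Variable n : nat.
Hypothesis n_gt1 : (1 < n)%N.
Implicit Types (u v : 'cV[rat]_n) (s : seq 'I_n).

Lemma ht_simple_root (i : 'I_n) : ht (simple_root i) = 1.
Proof.
rewrite /simple_root /ht; case: ifPn => ltin; rewrite ?dotDr ?dotNr -!/(ht _).
  rewrite !ht_evec // (_ : (n.-1 - i = (n.-1 - i.+1).+1)%N); last by lia.
  by rewrite mulrSr; lra.
have [lt1 lt2] : (n.-2 < n)%N /\ (n.-1 < n)%N by lia.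
rewrite !ht_evec // subnn addr0 (_ : (n.-1 - n.-2 = 1)%N) //; lia.
Qed.

Lemma root_simple_root (i : 'I_n) : is_root (simple_root i).
Proof.
rewrite /simple_root; case: ifPn => ltin; split.
- by apply: integralB; apply: integral_evec.
- rewrite dotBl !dotBr !dot_evec // !eqxx (gtn_eqF (ltnSn i)) (ltn_eqF (ltnSn i)).
  by rewrite /=; lra.
- by apply: integralD; apply: integral_evec.
have [lt1 lt2] : (n.-2 < n)%N /\ (n.-1 < n)%N by lia.
have lt12 : (n.-2 < n.-1)%N by lia.
by rewrite dotDl !dotDr !dot_evec // !eqxx (gtn_eqF lt12) (ltn_eqF lt12) /=; lra.
Qed.

Lemma reflection_rootE (a v : 'cV[rat]_n) :
  is_root a -> reflection a *m v = v - dot a v *: a.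
Proof.
move=> [_ a2]; have a2' : (a^T *m a) 0 0 = 2 := a2.
rewrite /reflection /coroot a2' divff // scale1r.
rewrite mulmxBl mul1mx -mulmxA [a^T *m v]mx11_scalar mul_mx_scalar //.
Qed.

Lemma reflection_rootN (a : 'cV[rat]_n) : is_root a -> reflection a *m a = - a.
Proof.
by move=> ra; rewrite reflection_rootE // ra.2 scaler_nat mulr2n opprD addNKr.
Qed.

Lemma reflection_orthogonal (a v : 'cV[rat]_n) :
  is_root a -> dot a v = 0 -> reflection a *m v = v.
Proof. by move=> ra av0; rewrite reflection_rootE // av0 scale0r subr0. Qed.

Lemma tr_reflection (a : 'cV[rat]_n) : (reflection a)^T = reflection a.
Proof.
rewrite /reflection /coroot linearB /= trmx1; congr (_ - _).
by rewrite -scalemxAr linearZ /= trmx_mul trmxK.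
Qed.

Lemma reflectionK (a : 'cV[rat]_n) :
  is_root a -> reflection a *m reflection a = 1%:M.
Proof.
move=> ra; rewrite {2}/reflection mulmxBr mulmx1 mulmxA reflection_rootN //.
by rewrite mulNmx opprK subrK.
Qed.

Lemma pairing_root (a v : 'cV[rat]_n) : is_root a -> pairing a v = dot a v.
Proof.
move=> [_ a2]; have a2' : (a^T *m a) 0 0 = 2 := a2.
by rewrite /pairing /coroot a2' divff // scale1r.
Qed.

Lemma reflection_mulmxC (a b : 'cV[rat]_n) : is_root a -> is_root b ->
  dot a b = 0 -> reflection a *m reflection b = reflection b *m reflection a.
Proof.
move=> ra rb ab0; have -> : reflection b = 1%:M - b *m coroot b by [].
rewrite mulmxBr [RHS]mulmxBl mulmx1 mul1mx.
congr (_ - _); rewrite mulmxA reflection_orthogonal // -mulmxA; congr (_ *m _).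
rewrite /coroot -scalemxAl; congr (_ *: _).
by rewrite -[RHS]trmxK trmx_mul trmxK tr_reflection reflection_orthogonal.
Qed.

Lemma root_reflection (a v : 'cV[rat]_n) :
  is_root a -> is_root v -> is_root (reflection a *m v).
Proof.
move=> ra rv; rewrite reflection_rootE //; case: ra rv => [aint a2] [vint v2].
split.
  by apply: integralB => //; apply: integralZ => //; apply: dot_int.
rewrite dotBl !dotBr !dotZl !dotZr a2 v2 (dotC v); lra.
Qed.

(** As v is not alpha_i, its product with alpha_i is at most 1, so the positive integer height drops
    by at most 1; height 0 is impossible for a root. *)
Lemma ht_simple_reflection (i : 'I_n) v : is_root v -> 0 < ht v ->
  v <> simple_root i -> 0 < ht (simple_reflection i *m v).
Proof.
move=> rv hv vNi; have ri := root_simple_root i.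
have := root_ht_neq0 (root_reflection ri rv); rewrite -/(simple_reflection i).
have [le2 eq2] := root_dot_le2 ri rv; move: le2 eq2.
rewrite reflection_rootE // /ht dotBr dotZr -!/(ht _) ht_simple_root mulr1.
have /intrP[z ->] := dot_int ri.1 rv.1.
have /intrP[t ht_v] := ht_int rv.1; rewrite ht_v in hv *.
rewrite -!intrB ltr0z intr_eq0 (_ : 2 = 2%:~R) // ler_int eqr_int.
have -> : (simple_root i == v) = false by apply/eqP => e; case: vNi.
by move: hv; rewrite ltr0z; lia.
Qed.

Lemma word_prod_nil : word_prod [::] = 1%:M :> 'M[rat]_n.
Proof. by rewrite /word_prod big_nil. Qed.

Lemma word_prod_cons i s : word_prod (i :: s) = simple_reflection i *m word_prod s.
Proof. by rewrite /word_prod big_cons. Qed.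

Lemma word_prod_cat s1 s2 : word_prod (s1 ++ s2) = word_prod s1 *m word_prod s2.
Proof.
elim: s1 => [|i s1 IHs] /=; first by rewrite word_prod_nil mul1mx.
by rewrite !word_prod_cons IHs mulmxA.
Qed.

Lemma word_prod1 (i : 'I_n) : word_prod [:: i] = simple_reflection i.
Proof. by rewrite word_prod_cons word_prod_nil mulmx1. Qed.

Lemma simple_reflectionK (i : 'I_n) :
  simple_reflection i *m simple_reflection i = 1%:M :> 'M[rat]_n.
Proof. exact/reflectionK/root_simple_root. Qed.

Lemma word_prod_rev s : word_prod (rev s) = (word_prod s)^T.
Proof.
elim: s => [|i s IHs]; first by rewrite word_prod_nil trmx1.
rewrite rev_cons -cats1 word_prod_cat word_prod1 word_prod_cons IHs trmx_mul.
by rewrite tr_reflection.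
Qed.

Lemma word_prodK s : word_prod s *m (word_prod s)^T = 1%:M.
Proof.
elim: s => [|i s IHs]; first by rewrite word_prod_nil trmx1 mulmx1.
rewrite word_prod_cons trmx_mul mulmxA -(mulmxA (simple_reflection i)) IHs mulmx1.
by rewrite tr_reflection simple_reflectionK.
Qed.

Lemma word_prodVK s : (word_prod s)^T *m word_prod s = 1%:M.
Proof. exact/mulmx1C/word_prodK. Qed.

Lemma invmx_word_prod s : invmx (word_prod s) = (word_prod s)^T.
Proof.
have /mulmx1_unit[ws _] := word_prodK s.
by rewrite -[RHS](mulKmx ws) word_prodK mulmx1.
Qed.

Lemma tr_word_prod_cons i s (v : 'cV[rat]_n) :
  (word_prod (i :: s))^T *m v = (word_prod s)^T *m (simple_reflection i *m v).
Proof. by rewrite word_prod_cons trmx_mul tr_reflection mulmxA. Qed.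

Lemma tr_word_prod_cat s1 s2 (v : 'cV[rat]_n) :
  (word_prod (s1 ++ s2))^T *m v = (word_prod s2)^T *m ((word_prod s1)^T *m v).
Proof. by rewrite word_prod_cat trmx_mul mulmxA. Qed.

Lemma root_word_prod s v : is_root v -> is_root (word_prod s *m v).
Proof.
elim: s => [|i s IHs] rv; first by rewrite word_prod_nil mul1mx.
by rewrite word_prod_cons -mulmxA; apply/root_reflection/IHs/rv/root_simple_root.
Qed.

Lemma root_tr_word_prod s v : is_root v -> is_root ((word_prod s)^T *m v).
Proof. by rewrite -word_prod_rev; apply: root_word_prod. Qed.

Lemma dot_tr_word_prod s u v :
  dot ((word_prod s)^T *m u) ((word_prod s)^T *m v) = dot u v.
Proof. by rewrite dot_mulmxr trmxK mulmxA word_prodK mul1mx. Qed.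

Lemma word_prod_orthogonal s v :
  (forall i, i \in s -> dot (simple_root i) v = 0) -> word_prod s *m v = v.
Proof.
elim: s => [|i s IHs] sv; first by rewrite word_prod_nil mul1mx.
rewrite word_prod_cons -mulmxA IHs => [|j js]; last by rewrite sv // inE js orbT.
by apply: reflection_orthogonal; [exact: root_simple_root | rewrite sv // mem_head].
Qed.

Lemma dot_tr_word_prod_span s u v :
  (forall i, i \in s -> dot u (simple_root i) = 0) ->
  dot u ((word_prod s)^T *m v) = dot u v.
Proof.
move=> us; rewrite dot_mulmxr trmxK word_prod_orthogonal // => i /us.
by rewrite dotC.
Qed.

(** A letter can make only its own simple root negative, so v must reach such a simple root before
    its sign changes. *)
Lemma exchange s v : is_root v -> 0 < ht v -> ht ((word_prod s)^T *m v) < 0 ->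
  exists s1 i s2, s = s1 ++ i :: s2 /\ (word_prod s1)^T *m v = simple_root i.
Proof.
elim: s v => [|i s IHs] v rv hv.
  by rewrite word_prod_nil trmx1 mul1mx => /(lt_trans hv); rewrite ltxx.
rewrite tr_word_prod_cons; have [->|/eqP vNi] := eqVneq v (simple_root i).
  by exists [::], i, s; rewrite word_prod_nil trmx1 mul1mx.
case/IHs => [||s1 [j [s2 [-> e]]]].
- exact/root_reflection/rv/root_simple_root.
- exact: ht_simple_reflection.
by exists (i :: s1), j, s2; rewrite tr_word_prod_cons.
Qed.

Definition reduced s :=
  forall s', word_prod s' = word_prod s -> (size s <= size s')%N.

Lemma reduced_rev s : reduced s -> reduced (rev s).
Proof.
move=> red_s s' e; rewrite size_rev -(size_rev s'); apply: red_s.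
by rewrite word_prod_rev e word_prod_rev trmxK.
Qed.

Lemma simple_reflection_conj s i j :
  (word_prod s)^T *m simple_root i = simple_root j ->
  simple_reflection i *m word_prod s = word_prod s *m simple_reflection j.
Proof.
move=> e; have {}e : simple_root i = word_prod s *m simple_root j.
  by rewrite -e mulmxA word_prodK mul1mx.
have co (k : 'I_n) : coroot (simple_root k) = (simple_root k)^T.
  rewrite /coroot -/(dot _ _) (root_simple_root k).2 divff // scale1r //.
rewrite /simple_reflection /reflection mulmxBl mulmxBr mul1mx mulmx1 !co.
by rewrite {2}e trmx_mul -!mulmxA word_prodVK mulmx1 e -mulmxA.
Qed.

(** Conjugation by the word [s2] carries s_j to s_i, so the two letters cancel and leave a shorter
    word with the same product. *)
Lemma reduced_deletion s1 i s2 j s3 :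
  (word_prod s2)^T *m simple_root i = simple_root j ->
  ~ reduced (s1 ++ i :: s2 ++ j :: s3).
Proof.
move=> /simple_reflection_conj e /(_ (s1 ++ s2 ++ s3)).
rewrite !(word_prod_cat, word_prod_cons) (mulmxA (word_prod s2)) -e.
rewrite -(mulmxA _ (word_prod s2)).
rewrite (mulmxA (simple_reflection i)) simple_reflectionK mul1mx.
by move=> /(_ erefl); rewrite !size_cat /= size_cat /=; lia.
Qed.

(** If this root were negative, alpha_i would by exchange become the simple root of a letter of
    [s2], and that letter would cancel against [i]. *)
Lemma reduced_ht_tr s1 i s2 :
  reduced (s1 ++ i :: s2) -> 0 < ht ((word_prod s2)^T *m simple_root i).
Proof.
move=> red_s; have ri := root_simple_root i.
have := root_ht_neq0 (root_tr_word_prod s2 ri); rewrite neq_lt => /orP[neg|//].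
case: (exchange _ _ neg) => // [|t1 [j [t2 [e ej]]]].
  by rewrite ht_simple_root.
by rewrite e in red_s; case: (reduced_deletion ej red_s).
Qed.

Lemma reduced_ht s1 i s2 :
  reduced (s1 ++ i :: s2) -> 0 < ht (word_prod s1 *m simple_root i).
Proof.
move/reduced_rev; rewrite rev_cat rev_cons -cats1 -catA => /reduced_ht_tr.
by rewrite word_prod_rev trmxK.
Qed.

End Words.

(** * Roots in the nilradical of a minuscule parabolic *)

Section Minuscule.
Variables (n : nat) (r : 'I_n).
Hypothesis n_ge4 : (4 <= n)%N.
Hypothesis r_minuscule : minuscule_index r.
Implicit Types (u v : 'cV[rat]_n) (l : seq 'I_n).

Let n_gt1 : (1 < n)%N. Proof. by lia. Qed.

(** Nonnegative integral combinations of simple roots are represented by lists of indices with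
    repetition; this difference telescopes. *)
Lemma evecB_sum (i j : nat) : (i <= j < n)%N ->
  exists l, evec n i - evec n j = \sum_(k <- l) simple_root k.
Proof.
elim: j => [|j IHj]; first by case: i => // _; exists [::]; rewrite subrr big_nil.
case/andP; rewrite leq_eqVlt => /orP[/eqP -> _|ltij ltjn].
  by exists [::]; rewrite subrr big_nil.
case: IHj => [|l e]; first by lia.
have ltjn' : (j < n)%N by lia.
exists (Ordinal ltjn' :: l); rewrite big_cons -e /simple_root /= ltjn.
by rewrite [RHS]addrC addrA subrK.
Qed.

Lemma evecD_sum (i j : nat) : (i < j < n)%N ->
  exists l, evec n i + evec n j = \sum_(k <- l) simple_root k.
Proof.
move=> ijn; have ltn1 : (n.-1 < n)%N by lia.
(* With indices from 0, e_i + e_j = (e_i - e_(n-2)) + (e_j - e_(n-1)) + (e_(n-2) + e_(n-1)), the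
   last bracket being the last simple root. *)
have [|l1 e1] := @evecB_sum i n.-2; first by lia.
have [|l2 e2] := @evecB_sum j n.-1; first by lia.
exists (Ordinal ltn1 :: l1 ++ l2).
rewrite big_cons big_cat /= -e1 -e2 /simple_root /= prednK ?ltnn; last by lia.
by apply/colP => k; rewrite !mxE; ring.
Qed.

Lemma pos_root_sum v : pos_root v ->
  exists l, v = \sum_(k <- l) simple_root k.
Proof.
case/pos_rootP=> i [j [b [ltij ->]]]; rewrite /sign_root.
have ltjn := ltn_ord j.
case: b; rewrite ?expr1 ?scaleN1r ?scale1r.
  by apply: evecB_sum; lia.
by apply: evecD_sum; lia.
Qed.

Lemma dot_sum u l : dot u (\sum_(k <- l) simple_root k) =
  \sum_(k <- l) dot u (simple_root k).
Proof.
elim: l => [|k l IHl]; first by rewrite !big_nil dot0r.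
by rewrite !big_cons dotDr IHl.
Qed.

(* A multiple of the fundamental coweight attached to alpha_r, scaled to have
   entries in {0, 1, -1}. *)
Definition coweight : 'cV[rat]_n :=
  \col_(j < n) if r == 0 :> nat then (j == 0 :> nat)%:R
               else if (j < n.-1)%N || (r == n.-1 :> nat) then 1 else -1.

Lemma dot_coweight_evec (i : nat) : (i < n)%N ->
  dot coweight (evec n i) =
    if r == 0 :> nat then (i == 0)%:R
    else if (i < n.-1)%N || (r == n.-1 :> nat) then 1 else -1.
Proof.
exact: (@dot_col_evec n (fun j : nat => if r == 0 :> nat then (j == 0)%:R
  else if (j < n.-1)%N || (r == n.-1 :> nat) then 1 else -1)).
Qed.

Lemma coweight_simple (i : 'I_n) : dot coweight (simple_root i) =
  if i == r then (if r == 0 :> nat then 1 else 2) else 0.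
Proof.
have ltrn := ltn_ord r; have ltin := ltn_ord i.
rewrite -val_eqE /= /simple_root; case: ifPn => lti.
  rewrite dotBr !dot_coweight_evec //; case/or3P: r_minuscule => /eqP re;
    rewrite re /=; repeat (case: ifP || case: eqP) => /= *; lra || (exfalso; lia).
have [lt1 lt2] : (n.-2 < n)%N /\ (n.-1 < n)%N by lia.
have -> : i = n.-1 :> nat by lia.
have n1N0 : (n.-1 == 0)%N = false by lia.
have n2N0 : (n.-2 == 0)%N = false by lia.
have n1Nn2 : (n.-1 == n.-2)%N = false by lia.
rewrite dotDr !dot_coweight_evec // ltnn (_ : (n.-2 < n.-1)%N = true); last by lia.
case/or3P: r_minuscule => /eqP -> /=.
- by rewrite n1N0 n2N0 addr0.
- by rewrite n2N0 n1Nn2 [(n.-2 == n.-1)%N]eq_sym n1Nn2 subrr.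
by rewrite n1N0 eqxx; lra.
Qed.

Lemma coweight_simple_gt0 (i : 'I_n) :
  (0 < dot coweight (simple_root i)) = (i == r).
Proof. by rewrite coweight_simple; case: eqP => // _; case: eqP. Qed.

Lemma coweight_simple_ge0 (i : 'I_n) : 0 <= dot coweight (simple_root i).
Proof. by rewrite coweight_simple; case: eqP => // _; case: eqP. Qed.

Lemma coweight_sum_eq0 l :
  dot coweight (\sum_(k <- l) simple_root k) = 0 -> r \notin l.
Proof.
rewrite dot_sum; elim: l => // k l IHl; rewrite big_cons in_cons negb_or => e.
have h1 := coweight_simple_ge0 k.
have h2 : 0 <= \sum_(j <- l) dot coweight (simple_root j).
  by apply: sumr_ge0 => j _; exact: coweight_simple_ge0.
rewrite IHl ?andbT; last by lra.
rewrite eq_sym -coweight_simple_gt0; lra.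
Qed.

(* alpha_r being minuscule, its coefficient in a positive root is 0 or 1. *)
Lemma coweight_pos_root v : pos_root v -> dot coweight v != 0 ->
  dot coweight v = dot coweight (simple_root r).
Proof.
case/pos_rootP=> i [j [b [ltij ->]]]; have ltjn := ltn_ord j.
rewrite coweight_simple eqxx /sign_root dotDr dotZr !dot_coweight_evec //.
case: ifPn => [r0|rN0].
  by rewrite [(j == 0 :> nat)]gtn_eqF ?mulr0 ?addr0; [case: (i == 0 :> nat)|lia].
rewrite (_ : (i < n.-1)%N = true) /=; last by lia.
by case: b; case: ifP => _; rewrite ?expr0 ?expr1 => *; lra.
Qed.

(** The roots of the unipotent radical of $P^{\alpha_r}$. *)
Definition nilradical_root v := pos_root v && (0 < dot coweight v).

Lemma nilradical_coweight v : nilradical_root v ->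
  dot coweight v = dot coweight (simple_root r).
Proof. by case/andP=> ? h; apply: coweight_pos_root => //; rewrite gt_eqF. Qed.

(** A product -2 would make u = -v, against the positive coweights; a product -1 would make u + v a
    positive root with alpha_r-coefficient 2. *)
Lemma nilradical_dot_ge0 u v :
  nilradical_root u -> nilradical_root v -> 0 <= dot u v.
Proof.
move=> nu nv; have eu := nilradical_coweight nu; have ev := nilradical_coweight nv.
case/andP: nu => pu cu; case/andP: nv => pv cv.
have ru := pos_root_root pu; have rv := pos_root_root pv.
rewrite leNgt; apply/negP => uv_lt0.
have rN := is_rootN rv; have [le2 eq2] := root_dot_le2 ru rN.
move: le2 eq2; rewrite dotNr.
have [z uvz] : exists z : int, dot u v = z%:~R by apply/intrP; exact: dot_int ru.1 rv.1.
rewrite uvz ltrz0 in uv_lt0 *.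
rewrite -intrN (_ : 2 = 2%:~R) // ler_int eqr_int => le2 eq2.
have [uNv|uNv] := eqVneq u (- v).
  by move: cu; rewrite uNv dotNr; lra.
have zE : z = -1 by move: eq2; rewrite (negPf uNv); lia.
have ruv : is_root (u + v).
  split; first by apply: integralD; [exact: ru.1 | exact: rv.1].
  by rewrite dotDl !dotDr (dotC v) ru.2 rv.2 uvz zE; lra.
have puv : pos_root (u + v).
  rewrite pos_rootE // /ht dotDr addr_gt0 // -/(ht _) -pos_rootE //.
have := coweight_pos_root puv; rewrite dotDr eu ev.
have : 0 < dot coweight (simple_root r) by rewrite coweight_simple_gt0.
move=> c0 /(_ _)/eqP; rewrite gt_eqF; last by lra.
by move=> /(_ isT); lra.
Qed.

Lemma sumD u v : (exists l, u = \sum_(k <- l) simple_root k) ->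
  (exists l, v = \sum_(k <- l) simple_root k) ->
  exists l, u + v = \sum_(k <- l) simple_root k.
Proof. by move=> [l ->] [l' ->]; exists (l ++ l'); rewrite big_cat. Qed.

Lemma dot_sign_root u (i j : 'I_n) (b : bool) :
  dot u (sign_root i j b) = dot u (evec n i) + (-1) ^+ b * dot u (evec n j).
Proof. by rewrite /sign_root dotDr dotZr. Qed.

Lemma nilradical_root0P v : r = 0 :> nat -> nilradical_root v ->
  exists (j : 'I_n) (b : bool), (0 < j)%N /\ v = evec n 0 + (-1) ^+ b *: evec n j.
Proof.
move=> r0 /andP[/pos_rootP[i [j [b [ltij ->]]]]].
rewrite dot_sign_root !dot_coweight_evec // r0 /=.
rewrite (_ : (j == 0 :> nat) = false) ?mulr0 ?addr0; last by lia.
case: (eqVneq (i : nat) 0%N) => [i0 _|]; last by rewrite ltxx.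
by exists j, b; split; [lia | rewrite /sign_root i0].
Qed.

(** Here [coweight] is (1, ..., 1) or (1, ..., 1, -1), and a positive product with it forces the
    sign of e_j to agree with its entry at j. *)
Lemma nilradical_rootP v : r <> 0 :> nat -> nilradical_root v ->
  exists i j : 'I_n, (i < j)%N /\
    v = sign_root i j ((j == n.-1 :> nat) && (r == n.-2 :> nat)).
Proof.
move=> rN0 /andP[/pos_rootP[i [j [b [ltij ->]]]]].
rewrite dot_sign_root !dot_coweight_evec //.
have ltjn := ltn_ord j; have -> : (r == 0 :> nat) = false by lia.
have -> : (i < n.-1)%N = true by lia.
move=> h; exists i, j; split=> //; congr sign_root; move: h.
case/or3P: r_minuscule => /eqP re; first by lia.
  rewrite re eqxx andbT (_ : (n.-2 == n.-1)%N = false) ?orbF; last by lia.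
  have -> : (j < n.-1)%N = (j != n.-1 :> nat) by lia.
  by case: eqP => _; case: b; rewrite /= ?expr0 ?expr1 // => h; absurd_lra.
rewrite re eqxx !orbT (_ : (n.-1 == n.-2)%N = false) ?andbF; last by lia.
by case: b; rewrite /= ?expr0 ?expr1 // => h; absurd_lra.
Qed.

(** * Comparing a root orthogonal to a set of letters with a root in their span *)

Section OrthogonalComparison.
Variables (J : seq 'I_n) (g e : 'cV[rat]_n).
Hypothesis J_r : r \in J.
Hypotheses (g_nil : nilradical_root g) (e_nil : nilradical_root e).
Hypothesis g_orth : forall i, i \in J -> dot g (simple_root i) = 0.
(** Membership of [e] in the span of the simple roots of [J], stated by duality so that it can be
    tested on vectors u. *)
Hypothesis e_span : forall u,
  (forall i, i \in J -> dot u (simple_root i) = 0) -> dot u e = 0.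

(** Orthogonality to alpha_r = e_0 - e_1 leaves only the highest root e_0 + e_1 for [g]. *)
Let comparison0 : r = 0 :> nat ->
  exists l, g - e = \sum_(k <- l) simple_root k.
Proof.
move=> r0; have [j [b [lt0j gE]]] := nilradical_root0P r0 g_nil.
have [j' [b' [lt0j' ->]]] := nilradical_root0P r0 e_nil.
have ltjn := ltn_ord j; have ltjn' := ltn_ord j'.
have lt0n : (0 < n)%N by lia.
have -> : g = evec n 0 + evec n 1.
  have := g_orth J_r; rewrite gE /simple_root r0 n_gt1 dotDl dotZl !dotBr.
  rewrite !dot_evec // eqxx (_ : (j == 0 :> nat) = false) ?sub0r; last by lia.
  case: (eqVneq (j : nat) 1%N) => [->|_]; last by rewrite /= oppr0 mulr0 => h; absurd_lra.
  by case: b {gE}; rewrite /= ?expr0 ?expr1 ?scale1r // => h; absurd_lra.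
rewrite opprD addrACA subrr add0r -scaleNr -signrN.
case: b' => /=; rewrite ?expr0 ?expr1 ?scale1r ?scaleN1r; last first.
  by apply: evecB_sum; lia.
have [->|jN1] := eqVneq (j' : nat) 1%N; last by apply: evecD_sum; lia.
(* Here [e] is e_0 - e_1, and the difference 2 e_1 is not a root but a sum of two positive roots. *)
have -> : evec n 1 + evec n 1 = (evec n 1 - evec n 2) + (evec n 1 + evec n 2).
  by apply/colP => k; rewrite !mxE; ring.
by apply: sumD; [apply: evecB_sum; lia | apply: evecD_sum; lia].
Qed.

(** Orthogonality to alpha_r keeps both indices a < b of [g] off the last two coordinates, and the
    span condition pushes both indices c < d of [e] beyond b. Then [g - e] is e_a - e_c plus e_b -
    e_d or e_b + e_d. *)
Let comparisonN0 : r <> 0 :> nat ->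
  exists l, g - e = \sum_(k <- l) simple_root k.
Proof.
move=> rN0; have [a [b [ltab gE]]] := nilradical_rootP rN0 g_nil.
have [c [d [ltcd eE]]] := nilradical_rootP rN0 e_nil.
have := (ltn_ord a, ltn_ord b, ltn_ord c, ltn_ord d); move=> [[[ltan ltbn] ltcn] ltdn].
have [lt1 lt2] : (n.-2 < n)%N /\ (n.-1 < n)%N by lia.
have ltb : (b < n.-2)%N.
  have := g_orth J_r; rewrite gE dotC dot_sign_root /simple_root.
  have n2S : n.-2.+1 = n.-1 by lia.
  have n1S : n.-1.+1 = n by lia.
  case/or3P: r_minuscule => /eqP re; first by lia.
    rewrite re eqxx andbT n2S lt2 !dotBl !dot_evec //.
    do 5! [case: eqP => ?]; rewrite /= ?expr0 ?expr1 => *; lia || absurd_lra.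
  have n12 : (n.-1 == n.-2)%N = false by lia.
  rewrite re n1S ltnn n12 andbF !dotDl !dot_evec //.
  do 4! [case: eqP => ?]; rewrite /= ?expr0 ?expr1 => *; lia || absurd_lra.
have {}gE : g = evec n a + evec n b.
  by rewrite gE /sign_root (_ : (b == n.-1 :> nat) = false) ?scale1r //; lia.
(* u vanishes on J, so e has no nonzero coordinate in a position <= b. *)
pose u : 'cV[rat]_n := \col_(k < n) (k <= b)%:R.
have uE (k : nat) : (k < n)%N -> dot u (evec n k) = (k <= b)%:R.
  exact: (@dot_col_evec n (fun k => (k <= b)%:R)).
have : dot u e = 0.
  apply: e_span => i /g_orth; rewrite gE /simple_root.
  case: ifPn => lti.
    (* Only alpha_b is not orthogonal to [u], and its product with [g] is 1, so b is not in [J]. *)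
    have [ib|iNb] := eqVneq (i : nat) b.
      rewrite ib in lti *; rewrite !dotBr !dotDl !dot_evec // eqxx.
      have -> : (a == b :> nat) = false by lia.
      have -> : (a == b.+1 :> nat) = false by lia.
      have -> : (b == b.+1 :> nat) = false by lia.
      by rewrite /= => *; absurd_lra.
    move=> _; rewrite dotBr !uE //.
    have -> : (i.+1 <= b)%N = (i <= b)%N by lia.
    exact: subrr.
  move=> _; rewrite dotDr !uE //.
  have -> : (n.-2 <= b)%N = false by lia.
  have -> : (n.-1 <= b)%N = false by lia.
  exact: addr0.
rewrite eE dot_sign_root !uE // => ue.
have ltbc : (b < c)%N.
  rewrite ltnNge; apply/negP => lecb; move: ue; rewrite lecb.
  case: (leqP d b) => ltdb; last by rewrite mulr0 addr0.
  have -> : (d == n.-1 :> nat) = false by lia.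
  by rewrite /= expr0 => h; absurd_lra.
rewrite gE /sign_root opprD addrACA.
apply: sumD; first by apply: evecB_sum; lia.
case: (_ && _); rewrite ?expr1 ?scaleN1r ?opprK ?expr0 ?scale1r.
  by apply: evecD_sum; lia.
by apply: evecB_sum; lia.
Qed.

(** Both roots have alpha_r-coefficient 1, so alpha_r cancels in the difference. *)
Lemma orthogonal_comparison :
  exists2 l, r \notin l & g - e = \sum_(k <- l) simple_root k.
Proof.
have [l gel] : exists l, g - e = \sum_(k <- l) simple_root k.
  by have [r0|/eqP rN0] := eqVneq (r : nat) 0; [exact: comparison0 | exact: comparisonN0].
exists l => //; apply: coweight_sum_eq0.
by rewrite -gel dotBr !nilradical_coweight // subrr.
Qed.

End OrthogonalComparison.


(** * Inversions of minimal coset representatives *)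

Definition right_minimal (t : seq 'I_n) :=
  forall i, i \in [set~ r] -> pos_root (word_prod t *m simple_root i).

Lemma ht_sum l : ht (\sum_(k <- l) simple_root k) = (size l)%:R.
Proof.
elim: l => [|k l IHl]; first by rewrite big_nil /ht dot0r.
by rewrite big_cons /ht dotDr -!/(ht _) ht_simple_root // IHl -natr1 addrC.
Qed.

Lemma right_minimal_ht t l : right_minimal t -> r \notin l -> l != [::] ->
  0 < ht (word_prod t *m \sum_(k <- l) simple_root k).
Proof.
move=> t_dom; elim: l => // k l IHl; rewrite in_cons negb_or => /andP[rNk rNl] _.
have kr : k \in [set~ r] by rewrite !inE eq_sym.
have := t_dom k kr; rewrite pos_rootE; last first.
  exact/root_word_prod/root_simple_root.
rewrite big_cons mulmxDr /ht dotDr -!/(ht _) => k_gt0.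
case: (eqVneq l [::]) => [->|lN0]; last by rewrite addr_gt0 ?IHl.
by rewrite big_nil mulmx0 {2}/ht dot0r addr0.
Qed.

(** Without alpha_r, this root would be a sum of simple roots that the whole word keeps positive;
    but by reducedness the word makes it negative. *)
Lemma inversion_nilradical t1 i t2 :
  reduced (t1 ++ i :: t2) -> right_minimal (t1 ++ i :: t2) ->
  nilradical_root ((word_prod t2)^T *m simple_root i).
Proof.
move=> red_t t_dom; have ri := root_simple_root n_gt1 i.
have pv : pos_root ((word_prod t2)^T *m simple_root i).
  by rewrite pos_rootE ?(reduced_ht_tr _ red_t) //; apply: root_tr_word_prod.
rewrite /nilradical_root pv /=; have [l vE] := pos_root_sum pv.
rewrite lt_def; apply/andP; split; last first.
  by rewrite vE dot_sum sumr_ge0 // => k _; exact: coweight_simple_ge0.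
apply/eqP => v0; rewrite vE in v0; have rNl := coweight_sum_eq0 v0.
have lN0 : l != [::].
  apply: contraTneq pv => l0; rewrite vE l0 big_nil; apply/negP => /pos_root_root[_].
  by rewrite dot0r => /esym/eqP; rewrite pnatr_eq0.
have := right_minimal_ht t_dom rNl lN0.
rewrite -vE word_prod_cat word_prod_cons -!mulmxA (mulmxA (word_prod t2)).
rewrite word_prodK // mul1mx reflection_rootN // mulmxN /ht dotNr -/(ht _).
by have := reduced_ht n_gt1 red_t; lra.
Qed.

(** Each letter adds its simple root, taken minus the product many times. If nothing is ever added,
    v stays fixed and every product vanishes. *)
Lemma tr_word_prod_increase t v : integral v ->
  (forall t1 j t2, t = t1 ++ j :: t2 ->
     dot (simple_root j) ((word_prod t1)^T *m v) <= 0) ->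
  exists l, (word_prod t)^T *m v - v = \sum_(k <- l) simple_root k /\
    (l = [::] -> forall j, j \in t -> dot (simple_root j) v = 0).
Proof.
elim: t v => [|j t IHt] v vint v_le0.
  by exists [::]; rewrite word_prod_nil trmx1 mul1mx subrr big_nil.
have rj := root_simple_root n_gt1 j.
have dj_le0 : dot (simple_root j) v <= 0.
  by have := v_le0 [::] j t erefl; rewrite word_prod_nil trmx1 mul1mx.
have [c cE] : exists c : nat, dot (simple_root j) v = - c%:R.
  have /intrP[z zE] := dot_int rj.1 vint.
  move: dj_le0; rewrite zE lerz0 => z_le0.
  by exists `|z|%N; rewrite natr_absz ler0_norm // intrN opprK.
have sjv : simple_reflection j *m v = v + c%:R *: simple_root j.
  by rewrite reflection_rootE // cE scaleNr opprK.
case: (IHt (simple_reflection j *m v)) => [|t1 k t2 tE|l [lE l0]].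
- by rewrite sjv; apply: integralD => //; apply: integralZ => //; exact: rj.1.
- by have := v_le0 (j :: t1) k t2; rewrite tE tr_word_prod_cons //; exact.
exists (nseq c j ++ l); split.
  rewrite big_cat big_nseq /= iter_addr_0 -lE tr_word_prod_cons // -scaler_nat.
  by move: (_ *m (_ *m v)) => x; rewrite sjv opprD addrCA; congr (_ + _);
    rewrite addrCA subrr addr0.
case: c cE sjv => // cE sjv /= /l0 {}l0 i; rewrite inE => /orP[/eqP->|/l0].
  by rewrite cE oppr0.
by rewrite sjv scale0r addr0.
Qed.

Lemma sum_count l : \sum_(k <- l) simple_root k =
  \sum_i (count_mem i l)%:R *: simple_root i :> 'cV[rat]_n.
Proof.
elim: l => [|k l IHl].
  by rewrite big_nil big1 // => i _; rewrite scale0r.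
rewrite big_cons IHl [RHS](eq_bigr (fun i => (k == i)%:R *: simple_root i +
   (count_mem i l)%:R *: simple_root i)) => [|i _]; last by rewrite /= natrD scalerDl.
rewrite big_split /=; congr (_ + _); rewrite (bigD1 k) //= eqxx scale1r big1 ?addr0 //.
by move=> i iNk; rewrite eq_sym (negPf iNk) scale0r.
Qed.

(** * The two factors of a minimal coset representative *)

Section Factorisation.
Variables (c : 'I_n) (t1 t2 : seq 'I_n).
Hypothesis red_t : reduced (t1 ++ t2).
Hypothesis t_dom : right_minimal (t1 ++ t2).
Hypothesis c_desc : ht ((word_prod t1)^T *m simple_root c) < 0.

Let g1 := - ((word_prod t1)^T *m simple_root c).
Let g := - ((word_prod (t1 ++ t2))^T *m simple_root c).

Let gE : g = (word_prod t2)^T *m g1.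
Proof. by rewrite /g /g1 tr_word_prod_cat // mulmxN. Qed.

(** By exchange, alpha_c becomes the simple root of some letter of [t1], so [g] is the inversion
    attached to that letter in the full word. *)
Lemma descent_nilradical : nilradical_root g.
Proof.
have rc := root_simple_root n_gt1 c.
case: (exchange n_gt1 rc _ c_desc); first by rewrite ht_simple_root.
move=> a [i [b [tE iE]]]; rewrite gE /g1 tE tr_word_prod_cat // tr_word_prod_cons //.
rewrite iE reflection_rootN; last exact: root_simple_root.
rewrite !mulmxN opprK -tr_word_prod_cat //; apply: (@inversion_nilradical a).
  by move: red_t; rewrite tE -catA.
by move: t_dom; rewrite tE -catA.
Qed.

Lemma factorisation_increase :
  exists l, g - g1 = \sum_(k <- l) simple_root k /\
    (l = [::] -> forall j, j \in t2 -> dot (simple_root j) g1 = 0).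
Proof.
rewrite gE; apply: tr_word_prod_increase => [|a j b t2E].
  exact: (is_rootN (root_tr_word_prod n_gt1 t1 (root_simple_root n_gt1 c))).1.
have rj := root_simple_root n_gt1 j.
have j_nil : nilradical_root ((word_prod b)^T *m simple_root j).
  by apply: (@inversion_nilradical (t1 ++ a)); rewrite -catA -t2E.
(* Applying the letters from j on to both arguments turns the product to be bounded into minus the
   product of two inversions of the full word. *)
have := nilradical_dot_ge0 j_nil descent_nilradical.
rewrite gE t2E tr_word_prod_cat // tr_word_prod_cons // dot_tr_word_prod //.
rewrite dot_mulmxr tr_reflection reflection_rootN // dotNl.
by rewrite oppr_ge0.
Qed.

Lemma factorisation_dominates :
  dominates ((word_prod t1)^T *m simple_root c)
            ((word_prod (t1 ++ t2))^T *m simple_root c).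
Proof.
have [l [lE _]] := factorisation_increase.
exists (fun i => count_mem i l); rewrite -sum_count -lE /g /g1 opprK.
by rewrite addrC.
Qed.

(** The orthogonality assumption makes [word_prod t1] fix alpha_b, so the full word sends the
    inversion attached to [b] to -alpha_b; the final contradiction is that alpha_b - alpha_c has
    height 1 - 1 = 0. *)
Lemma factorisation_strict b t2' : t2 = b :: t2' ->
  (forall i, i \in t1 -> dot (simple_root i) (simple_root b) = 0) ->
  (word_prod t1)^T *m simple_root c <> (word_prod (t1 ++ t2))^T *m simple_root c.
Proof.
move=> t2E b_orth e; have [l [lE l0]] := factorisation_increase.
have g1E : g1 = g by rewrite /g1 /g e.
have l_nil : l = [::].
  apply/eqP; rewrite -size_eq0 -(eqr_nat rat) -ht_sum -lE g1E subrr.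
  by rewrite /ht dot0r.
have {l lE l_nil l0} g_orth : forall j, j \in t2 -> dot g (simple_root j) = 0.
  by move=> j jt2; rewrite dotC -g1E l0.
have e_nil : nilradical_root ((word_prod t2')^T *m simple_root b).
  by apply: (@inversion_nilradical t1); rewrite -t2E.
(* The last letter x of the word has alpha_x itself as inversion, and this lies in the nilradical
   only if x = r. *)
have r_t2 : r \in t2.
  case: (lastP t2) t2E red_t t_dom => // t x _.
  rewrite -cats1 catA => red_tx tx_dom.
  have := inversion_nilradical red_tx tx_dom.
  rewrite word_prod_nil trmx1 mul1mx => /andP[_]; rewrite coweight_simple_gt0.
  by move=> /eqP <-; rewrite mem_cat mem_head orbT.
have e_span u : (forall i, i \in t2 -> dot u (simple_root i) = 0) ->
    dot u ((word_prod t2')^T *m simple_root b) = 0.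
  move=> u_orth; rewrite dot_tr_word_prod_span // => [|i it]; apply: u_orth.
    by rewrite t2E mem_head.
  by rewrite t2E inE it orbT.
have [l rNl lE] := orthogonal_comparison r_t2 descent_nilradical e_nil g_orth e_span.
(* The two roots differ, being orthogonal to each other while [g] has square length 2. *)
have lN0 : l != [::].
  apply: contra_eqN (e_span g g_orth) => /eqP l0.
  move: lE; rewrite l0 big_nil => /subr0_eq <-.
  by case/andP: descent_nilradical => /pos_root_root[_ ->].
have := right_minimal_ht t_dom rNl lN0.
rewrite -lE mulmxBr /g mulmxN mulmxA word_prodK // mul1mx.
rewrite t2E word_prod_cat word_prod_cons -!mulmxA (mulmxA (word_prod t2')).
rewrite word_prodK // mul1mx reflection_rootN; last exact: root_simple_root.
rewrite mulmxN word_prod_orthogonal // opprK /ht dotDr dotNr -!/(ht _).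
by rewrite !ht_simple_root // addNr ltxx.
Qed.

End Factorisation.

End Minuscule.

(** * The quiver order as a heap *)

Section Heap.
Variables (n k : nat) (s : k.-tuple 'I_n).
Hypothesis n_gt1 : (1 < n)%N.
Hypothesis red_s : reduced s.
Implicit Types i j l : 'I_k.

Lemma root_beta i : is_root (beta s i).
Proof. exact: root_simple_root. Qed.

(** If every letter in between were orthogonal to the common root, the two occurrences would cancel,
    against reducedness. *)
Lemma reduced_same_colour_gap i j : (i < j)%N -> beta s j = beta s i ->
  exists l, [&& (i < l)%N, (l < j)%N & dot (beta s l) (beta s i) != 0].
Proof.
move=> ltij eqb; apply/existsP/contraT => /existsPn none.
have ltjk : (j < size s)%N by rewrite size_tuple.
have ltik : (i < size s)%N by rewrite size_tuple.
have sE : s = take i s ++ tnth s i :: take (j - i.+1) (drop i.+1 s) ++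
              tnth s j :: drop j.+1 s :> seq _.
  rewrite -[LHS](cat_take_drop i) (drop_nth (tnth s i) ltik) -tnth_nth.
  congr (_ ++ _ :: _); rewrite -[LHS](cat_take_drop (j - i.+1)) drop_drop subnK //.
  by rewrite (drop_nth (tnth s i) ltjk) -tnth_nth.
case: (@reduced_deletion n n_gt1 (take i s) (tnth s i)
        (take (j - i.+1) (drop i.+1 s)) (tnth s j) (drop j.+1 s)); last first.
  by rewrite -sE.
rewrite [RHS]eqb -word_prod_rev word_prod_orthogonal //.
move=> x; rewrite mem_rev => /(nthP (tnth s i))[d].
rewrite size_take_min size_drop leq_min.
case/andP=> ltd1 ltd2; rewrite nth_take // nth_drop => <-.
have ltdk : (i.+1 + d < k)%N by move: ltd2; rewrite size_tuple; lia.
have := none (Ordinal ltdk); rewrite /= (_ : (i < i.+1 + d)%N); last by lia.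
rewrite (_ : (i.+1 + d < j)%N) /=; last by lia.
by rewrite negbK /beta (tnth_nth (tnth s i)) => /eqP.
Qed.

Lemma arrowI i j : (i < j)%N -> dot (beta s j) (beta s i) != 0 ->
  (forall l, (i < l)%N -> beta s l = beta s i -> (j < l)%N) -> arrow s i j.
Proof.
move=> ltij dji succ; rewrite /arrow pairing_root ?dji ?ltij; last exact: root_beta.
by apply/forallP => l; apply/implyP => /and3P[ltil /eqP e _]; apply: succ.
Qed.

(** Induction on the distance reduces to consecutive occurrences. There, the last vertex l in
    between that is not orthogonal to the colour gives arrows from i to l and from l to j. *)
Lemma quiver_le_same_colour i j :
  (i < j)%N -> beta s j = beta s i -> quiver_le s i j.
Proof.
have [d] := ubnP (j - i); elim: d i j => // d IHd i j ltd ltij eqb.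
have [/existsP[l /and3P[ltil ltlj /eqP eqlb]]|/existsPn none] :=
    boolP [exists l : 'I_k, [&& (i < l)%N, (l < j)%N & beta s l == beta s i]].
  apply: (@connect_trans _ _ l); first by apply: IHd => //; lia.
  by apply: IHd => //; [lia | rewrite eqb eqlb].
have {}none l : (i < l)%N -> (l < j)%N -> beta s l <> beta s i.
  by move=> il lj /eqP e; have := none l; rewrite il lj e.
have [l0 Pl0] := reduced_same_colour_gap ltij eqb.
pose P l := [&& (i < l)%N, (l < j)%N & dot (beta s l) (beta s i) != 0].
case: (@arg_maxnP _ l0 P (fun l : 'I_k => l : nat) Pl0) => l /and3P[ltil ltlj dli] l_max.
apply: (@connect_trans _ _ l); apply/connect1/arrowI => //.
- move=> j' ltij' eqj'; rewrite ltnNge; apply/negP => lej'l.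
  by apply: (none j') => //; lia.
- by rewrite eqb dotC.
move=> l' ltll' eql'; rewrite ltn_neqAle leqNgt; apply/andP; split.
  by apply: contra_not_neq (none l ltil ltlj) => /val_inj e; rewrite -eqb e eql'.
apply/negP => ltl'j.
have := l_max l'; rewrite /P ltl'j eql' dli (ltn_trans ltil ltll') => /(_ isT) /=.
by rewrite leqNgt ltll'.
Qed.

(** If the colours differ, pass to the last vertex l before j with the colour of i: its successor,
    if any, comes after j, so l has an arrow to j. *)
Lemma quiver_le_nonorthogonal i j :
  (i < j)%N -> dot (beta s i) (beta s j) != 0 -> quiver_le s i j.
Proof.
move=> ltij dij; have [|/eqP neqb] := eqVneq (beta s j) (beta s i).
  exact: quiver_le_same_colour.
have Pi : (i < j)%N && (beta s i == beta s i) by rewrite ltij eqxx.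
case: (@arg_maxnP _ i (fun l : 'I_k => (l < j)%N && (beta s l == beta s i))
         (fun l : 'I_k => l : nat) Pi) => l /andP[ltlj /eqP eql] l_max.
apply: (@connect_trans _ _ l).
  have := l_max i Pi; rewrite /= leq_eqVlt => /orP[/eqP/val_inj ->|ltil].
    exact: connect0.
  exact: quiver_le_same_colour.
apply/connect1/arrowI => //; first by rewrite eql dotC.
move=> l' ltll' eql'; rewrite ltn_neqAle leqNgt; apply/andP; split.
  by apply: contra_not_neq neqb => /val_inj e; rewrite e eql' eql.
apply/negP => ltl'j; have := l_max l'; rewrite ltl'j eql' eql eqxx => /(_ isT) /=.
by rewrite leqNgt ltll'.
Qed.

Lemma quiver_le_leq i j : quiver_le s i j -> (i <= j)%N.
Proof.
case/connectP=> c; elim: c i => [|l c IHc] i /=; first by move=> _ ->.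
by case/andP=> /and3P[_ ltil _] /IHc{}IHc /IHc; apply/leq_trans/ltnW.
Qed.

Lemma quiver_le_peak j : exists2 i, i \in peaks s & quiver_le s i j.
Proof.
case: (@arg_minnP _ j (fun i => quiver_le s i j) (fun i : 'I_k => i : nat)).
  exact: connect0.
move=> i le_ij i_min; exists i => //; rewrite inE; apply/forallP => l.
apply/implyP => le_li; rewrite -val_eqE eqn_leq /= quiver_le_leq //=.
exact/i_min/connect_trans/le_ij.
Qed.

(** * Splitting a reduced word along a down-closed set of vertices *)

Variable V : {set 'I_k}.
Hypothesis V_down : forall i j, j \in V -> quiver_le s i j -> i \in V.

Definition in_word := [seq tnth s v | v <- enum V].
Definition out_word := [seq tnth s v | v <- enum (~: V)].

Lemma sorted_enum (A : {set 'I_k}) : pairwise (fun i j : 'I_k => (i < j)%N) (enum A).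
Proof.
rewrite {1}/enum_mem -enumT; apply: subseq_pairwise (filter_subseq _ _) _.
rewrite -(pairwise_map val ltn) val_enum_ord -sorted_pairwise ?iota_ltn_sorted //.
exact: ltn_trans.
Qed.

(** A vertex outside [V] that precedes one in [V] has an orthogonal root, as otherwise it would be
    forced into [V]; so the letters of [V] commute to the front. *)
Lemma word_prod_split : word_prod (in_word ++ out_word) = word_prod s.
Proof.
rewrite -[tval s]map_tnth_enum /in_word /out_word.
have := sorted_enum setT; rewrite enum_setT -enumT.
rewrite {2 3}/enum_mem -enumT; elim: (enum 'I_k) => [//|i e IHe] /=.
case/andP=> /allP i_lt /IHe; rewrite !inE word_prod_cons => <- {IHe}.
case: ifPn => [iV|iNV] /=; first by rewrite word_prod_cons.
rewrite !word_prod_cat word_prod_cons !mulmxA; congr (_ *m _).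
(* It remains to commute the letter of i past the letters of [V] that follow it. *)
elim: e i_lt => [|j e IHe] i_lt /=; first by rewrite word_prod_nil mul1mx mulmx1.
case: ifP => [jV|_]; last by apply: IHe => l le; apply: i_lt; rewrite inE le orbT.
rewrite /= word_prod_cons -mulmxA IHe => [|l le]; last first.
  by apply: i_lt; rewrite inE le orbT.
have comm : simple_reflection (tnth s j) *m simple_reflection (tnth s i) =
    simple_reflection (tnth s i) *m simple_reflection (tnth s j).
  apply: reflection_mulmxC; [exact: root_simple_root | exact: root_simple_root |].
  apply/eqP/contraT => dji; case/negP: iNV; apply: V_down jV _.
  by apply: quiver_le_nonorthogonal; [apply: i_lt; rewrite mem_head | rewrite dotC].
rewrite [LHS]mulmxA comm; exact/esym/mulmxA.
Qed.

Lemma size_split : size (in_word ++ out_word) = k.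
Proof. by rewrite size_cat !size_map -!cardE cardsC card_ord. Qed.

Lemma reduced_split : reduced (in_word ++ out_word).
Proof.
by move=> s'; rewrite word_prod_split size_split => /red_s; rewrite size_tuple.
Qed.

End Heap.

(** * The first factor of the generalised decomposition *)

Theorem proposition4p13 (n : nat) (n_ge4 : (4 <= n)%N)
    (r : 'I_n) (r_minuscule : minuscule_index r)
    (w : 'M[rat]_n) (wWI : min_coset_rep [set~ r] w) (w_neq1 : w <> 1%:M)
    (k : nat) (s : k.-tuple 'I_n) (s_red : reduced_decomposition w s)
    (m : nat) (p : m.-tuple 'I_k) (p_peaks : peak_ordering s p)
    (w' : m.-tuple 'M[rat]_n) (w'E : w' = generalised_decomposition s p)
    (w'1 : 'M[rat]_n) (w'1E : w'1 = nth 1%:M w' 0)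
    (a : 'I_n) (a_neg : neg_root (invmx w'1 *m simple_root a)) :
  dominates (invmx w'1 *m simple_root a) (invmx w *m simple_root a) /\
  (invmx w'1 *m simple_root a = invmx w *m simple_root a <-> w = w'1) /\
  (w = w'1 <-> m = 1%N).
Proof.
have n_gt1 : (1 < n)%N by lia.
case: s_red => s_w s_min; case: p_peaks => _ p_peaks.
have red_s : reduced s by move=> s' e; apply: s_min; rewrite e.
have k_gt0 : (0 < k)%N.
  rewrite lt0n; apply/eqP => k0; apply: w_neq1; rewrite -s_w.
  by rewrite [tval s]size0nil ?size_tuple // word_prod_nil.
(* A nonempty quiver has a peak, so the first factor is a true entry and not the default value of
   [nth]. *)
have m_gt0 : (0 < m)%N.
  have [i + _] := quiver_le_peak s (Ordinal k_gt0).
  by rewrite -p_peaks; case: m p {p_peaks w' w'E w'1E} => // p; rewrite tuple0.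
(* Blocks are counted from 0: this is V_1, the vertices above none of the later peaks. *)
set V := block s p 0.
have VE v : (v \in V) = [forall u : 'I_m, (0 < u)%N ==> ~~ quiver_le s (tnth p u) v].
  by rewrite inE in_set0.
have V_down i j : j \in V -> quiver_le s i j -> i \in V.
  rewrite !VE => /forallP jV le_ij; apply/forallP => u; apply/implyP => u_gt0.
  by apply: contra (implyP (jV u) u_gt0) => le_ui; apply: connect_trans le_ij.
pose t1 := in_word s V; pose t2 := out_word s V.
have w1E : w'1 = word_prod t1.
  rewrite w'1E w'E (_ : 0%N = Ordinal m_gt0) // nth_mktuple.
  by rewrite /factor /word_prod /t1 /in_word big_map.
have wE : word_prod (t1 ++ t2) = w by rewrite word_prod_split.
have red_t : reduced (t1 ++ t2) by exact: reduced_split.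
have t_dom : right_minimal r (t1 ++ t2) by rewrite /right_minimal wE; exact: wWI.2.
have a_desc : ht ((word_prod t1)^T *m simple_root a) < 0.
  move: a_neg; rewrite /neg_root w1E invmx_word_prod // pos_rootE; last first.
    exact/is_rootN/root_tr_word_prod/root_simple_root.
  by rewrite /ht dotNr oppr_gt0.
rewrite w1E -wE !invmx_word_prod //; split.
  exact: (factorisation_dominates n_ge4 r_minuscule).
have [t2_nil|t2_neq0] := eqVneq t2 [::].
  (* A second peak lies above itself, hence outside [V], and would contribute a letter to [t2]. *)
  have m1 : m = 1%N.
    apply/eqP; rewrite eqn_leq m_gt0 andbT leqNgt; apply/negP => m_gt1.
    have : tnth p (Ordinal m_gt1) \in enum (~: V).
      rewrite mem_enum inE VE; apply/forallPn; exists (Ordinal m_gt1).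
      by rewrite negbK; exact: connect0.
    by move/(map_f (tnth s)); rewrite -/(out_word s V) -/t2 t2_nil.
  by rewrite t2_nil cats0.
have w_neq : word_prod (t1 ++ t2) <> word_prod t1.
  move=> /esym/red_t; rewrite size_cat -{2}[size t1]addn0 leq_add2l leqn0.
  by rewrite size_eq0 (negPf t2_neq0).
have m_neq1 : m <> 1%N.
  move=> m1; case/negP: t2_neq0; rewrite /t2 /out_word (_ : ~: V = set0) ?enum_set0 //.
  apply/setP => v; rewrite inE in_set0 VE; apply/negbF/forallP => u.
  by apply/implyP; have := ltn_ord u; lia.
(* Both other equalities fail in this case, so the two equivalences reduce to strictness. *)
suff neq : (word_prod t1)^T *m simple_root a <>
           (word_prod (t1 ++ t2))^T *m simple_root a by split; split.
have [q [e Ve]] : exists q e, enum (~: V) = q :: e.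
  move: t2_neq0; rewrite /t2 /out_word; case: (enum _) => // q e _.
  by exists q, e.
have qNV : q \in ~: V by rewrite -mem_enum Ve mem_head.
(* Some later peak lies below q and outside [V]. Its index is at most q, and q is the first vertex
   outside [V], so it is q. *)
have q_peak j : quiver_le s j q -> j = q.
  move: qNV; rewrite inE VE => /forallPn[u].
  rewrite negb_imply negbK => /andP[u_gt0 le_uq].
  have : tnth p u \in enum (~: V).
    rewrite mem_enum inE VE; apply/forallPn; exists u.
    by rewrite negb_imply u_gt0 negbK; exact: connect0.
  rewrite Ve inE => uqe; have uq : tnth p u = q.
    apply/eqP; case/orP: uqe => // ue; have := sorted_enum (~: V).
    rewrite Ve /= => /andP[/allP/(_ _ ue) /=].
    by rewrite ltnNge (quiver_le_leq le_uq).
  have : tnth p u \in peaks s by rewrite -p_peaks mem_tnth.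
  by rewrite uq inE => /forallP/(_ j)/implyP h /h/eqP.
apply: (factorisation_strict n_ge4 r_minuscule red_t t_dom a_desc (b := tnth s q)
  (t2' := [seq tnth s v | v <- e])); first by rewrite /t2 /out_word Ve.
move=> x /mapP[v]; rewrite mem_enum => vV ->.
(* A nonorthogonal v before q would lie below the peak q; one after q would force q into [V]. *)
apply/eqP/contraT => dvq; case: (ltngtP v q) => [ltvq|ltqv|/val_inj eqvq].
- have := q_peak v (quiver_le_nonorthogonal n_gt1 red_s ltvq dvq).
  by move=> evq; move: ltvq; rewrite evq ltnn.
- rewrite dotC in dvq; move: qNV.
  by rewrite inE (V_down q v) // quiver_le_nonorthogonal.
by move: qNV; rewrite -eqvq inE vV.
Qed.
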